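(* Let $R$ be a ring and let $S\subseteq R$ be a right Ore set consisting of regular elements of $R$. Let $Q'$ be the right quotient ring of $R$ with respect to $S$. If $Q'$ is right endo-Noetherian, then $R$ is right endo-Noetherian.
   Context: All rings are associative with identity, not necessarily commutative. For a ring $A$ and $a\in A$, the right annihilator is $r.\mathrm{ann}_A(a)=\{b\in A: ab=0\}$. A ring $A$ is called right endo-Noetherian if for every sequence $(a_i)_{i\in\mathbb N}$ of elements of $A$ with $r.\mathrm{ann}_A(a_1)\subseteq r.\mathrm{ann}_A(a_2)\subseteq\cdots$, there is a positive integer $n$ with $r.\mathrm{ann}_A(a_k)=r.\mathrm{ann}_A(a_n)$ for all $k\ge n$. An element is regular if it is neither a left nor a right zero divisor. A multiplicatively closed subset $S$ of $R$ (containing $1$) is a right Ore set if for all $r\in R$, $s\in S$ there exist $r'\in R$, $s'\in S$ with $rs'=sr'$. For such $S$ consisting of regular elements, the right quotient ring $Q'$ of $R$ with respect to $S$ is the ring containing $R$ as a subring in which every element of $S$ is invertible and every element has the form $rs^{-1}$ with $r\in R$, $s\in S$. *)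

(* Defs.v *)
From mathcomp Require Import all_boot all_algebra.
From mathcomp Require Import boolp classical_sets.

Set Implicit Arguments.
Unset Strict Implicit.
Unset Printing Implicit Defensive.

Import GRing.Theory.

Local Open Scope classical_set_scope.
Local Open Scope ring_scope.

(* Rings are [pzRingType]s: associative with identity, not necessarily
   commutative, and the zero ring is allowed. *)

Definition rann (A : pzRingType) (a : A) : set A := [set b | a * b = 0].

(* Sequences are indexed from 0 instead of 1. *)
Definition right_endo_noetherian (A : pzRingType) : Prop :=
  forall a : nat -> A,
    (forall i : nat, rann (a i) `<=` rann (a i.+1)) ->
    exists n : nat, forall k : nat, (n <= k)%N -> rann (a k) = rann (a n).

Definition left_zero_divisor (A : pzRingType) (a : A) : Prop :=
  exists b : A, b <> 0 /\ a * b = 0.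

Definition right_zero_divisor (A : pzRingType) (a : A) : Prop :=
  exists b : A, b <> 0 /\ b * a = 0.

Definition regular (A : pzRingType) (a : A) : Prop :=
  ~ left_zero_divisor a /\ ~ right_zero_divisor a.

Definition multiplicatively_closed (R : pzRingType) (S : set R) : Prop :=
  S 1 /\ (forall s t : R, S s -> S t -> S (s * t)).

Definition right_ore_set (R : pzRingType) (S : set R) : Prop :=
  multiplicatively_closed S /\
  (forall r s : R, S s ->
     exists r' s' : R, S s' /\ r * s' = s * r').

(* Inverses are given by a relation because a [pzRingType] has no inverse
   operation. *)
Definition is_inverse (A : pzRingType) (x y : A) : Prop :=
  x * y = 1 /\ y * x = 1.

(* [iota] is the inclusion of R in its quotient ring Q. *)
Definition is_right_quotient_ring (R : pzRingType) (S : set R)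
    (Q : pzRingType) (iota : {rmorphism R -> Q}) : Prop :=
  [/\ injective iota,
      (forall s : R, S s -> exists t : Q, is_inverse (iota s) t) &
      (forall q : Q, exists (r s : R) (t : Q),
         [/\ S s, is_inverse (iota s) t & q = iota r * t])].

(* Main.v *)
(* The map from the right annihilator of [a] in R to that of [iota a] in Q
   preserves inclusions, because [iota a * (iota r * t) = 0] with [t] invertible
   means [a * r = 0]; and [rann a] is the trace on R of [rann (iota a)].  So an
   ascending chain of annihilators in R extends to one in Q, and stops when the
   latter does. *)
Require Import Defs.
From mathcomp Require Import all_boot all_algebra.
From mathcomp Require Import boolp classical_sets.

Import GRing.Theory.
Local Open Scope classical_set_scope.
Local Open Scope ring_scope.

(** As [iota] is multiplicative and injective, [a * b] vanishes exactly when [iota a * iota b]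
    does. *)
Lemma rann_preimage (R Q : pzRingType) (iota : {rmorphism R -> Q}) (a : R) :
  injective iota -> iota @^-1` rann (iota a) = rann a.
Proof.
move=> iota_inj; apply/seteqP; split=> b /=; rewrite /rann /=.
  by move=> ab0; apply: iota_inj; rewrite rmorphM rmorph0.
by move=> ab0; rewrite -rmorphM ab0 rmorph0.
Qed.

Lemma rann_quotient_subset (R : pzRingType) (S : set R) (Q : pzRingType)
    (iota : {rmorphism R -> Q}) (a b : R) :
  is_right_quotient_ring S iota ->
  rann a `<=` rann b -> rann (iota a) `<=` rann (iota b).
Proof.
case=> iota_inj _ frac sub_ab q; rewrite /rann /= => aq0.
have [r [s [t [_ [_ ts1] q_def]]]] := frac q.
have ar0 : a * r = 0.
  apply: iota_inj.
  (* Clearing the denominator: [t * iota s = 1] gives [iota r = q * iota s], so [iota a * iota r =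
     (iota a * q) * iota s = 0]. *)
  by rewrite rmorphM rmorph0 -[iota r]mulr1 -ts1 (mulrA (iota r)) -q_def mulrA
             aq0 mul0r.
have br0 : b * r = 0 := sub_ab r ar0.
by rewrite q_def mulrA -rmorphM br0 rmorph0 mul0r.
Qed.

Theorem proposition1 (R : pzRingType) (S : set R)
  (S_ore : right_ore_set S)
  (S_regular : forall s : R, S s -> regular s)
  (Q : pzRingType) (iota : {rmorphism R -> Q})
  (Q_quotient : is_right_quotient_ring S iota)
  (Q_noeth : right_endo_noetherian Q) :
  right_endo_noetherian R.
Proof.
move=> a chain_a; have [iota_inj _ _] := Q_quotient.
have [i|n stable_n] := Q_noeth (iota \o a).
  exact: rann_quotient_subset Q_quotient (chain_a i).
exists n => k le_nk.
(* The index [n] found in [Q] serves for [R] too: both annihilators are preimages under [iota] of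
   annihilators that agree in [Q]. *)
by rewrite -!(@rann_preimage _ _ iota) //; congr (_ @^-1` _); exact: stable_n.
Qed.
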